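(* Let $n\ge 4$ be even, $\alpha_4,\dots,\alpha_n,\theta\in\mathbb{C}$, and let $L=F_1(\alpha_4,\alpha_5,\dots,\alpha_n,\theta)$. Then $L$ is non-strongly nilpotent if and only if the parameters satisfy at least one of the following: i) $\alpha_4\ne0$ and $\alpha_k=(-1)^kC^{2}_{k-3}\,\alpha_4^{k-3}$ for all $5\le k\le n-2$; ii) there is an integer $s$ with $3\le s\le\frac{n-2}{2}$ such that $\alpha_{(2s-3)t+3}=(-1)^{t+1}C^{2s-2}_{t}\,\alpha_{2s}^{t}$ for all $1\le t\le\lfloor\frac{n-5}{2s-3}\rfloor$, and $\alpha_j=0$ for every $4\le j\le n-2$ that is not of the form $j=(2s-3)t+3$ with $t$ a positive integer; iii) $\alpha_{2i}=0$ for all $2\le i\le\frac{n-2}{2}$. (The parameters not constrained in the respective case are arbitrary.) Here $C^{p}_{m}=\frac{1}{(p-1)m+1}\binom{pm}{m}$ is the $p$-th Catalan number.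
   Context: A (right) Leibniz algebra is a vector space $L$ with a bilinear bracket satisfying $[[x,y],z]=[[x,z],y]+[x,[y,z]]$ for all $x,y,z\in L$. A pre-derivation of $L$ is a linear map $P:L\to L$ with $P([[x,y],z])=[[P(x),y],z]+[[x,P(y)],z]+[[x,y],P(z)]$ for all $x,y,z\in L$. A Leibniz algebra is strongly nilpotent if every pre-derivation of it is a nilpotent linear map; otherwise it is non-strongly nilpotent. For $\alpha_4,\dots,\alpha_n,\theta\in\mathbb{C}$, $F_1(\alpha_4,\dots,\alpha_n,\theta)$ is the $n$-dimensional complex (filiform) Leibniz algebra with basis $e_1,\dots,e_n$ and products $[e_1,e_1]=e_3$; $[e_i,e_1]=e_{i+1}$ for $2\le i\le n-1$; $[e_1,e_2]=\sum_{t=4}^{n-1}\alpha_te_t+\theta e_n$; $[e_j,e_2]=\sum_{t=j+2}^{n}\alpha_{t-j+2}e_t$ for $2\le j\le n-2$; all omitted products of basis elements are zero. *)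

(* Defs.v *)
From HB Require Import structures.
From mathcomp Require Import all_boot all_order all_algebra.
From mathcomp Require Import zify.

Set Implicit Arguments.
Unset Strict Implicit.
Unset Printing Implicit Defensive.

Import GRing.Theory.
Local Open Scope ring_scope.

Record leibnizAlgebra (K : fieldType) := LeibnizAlgebra {
  leib_sort :> lmodType K;
  bracket : leib_sort -> leib_sort -> leib_sort;
  bracket_linearl : forall (a : K) (x y z : leib_sort),
    bracket (a *: x + y) z = a *: bracket x z + bracket y z;
  bracket_linearr : forall (a : K) (x y z : leib_sort),
    bracket x (a *: y + z) = a *: bracket x y + bracket x z;
  bracket_leibniz : forall x y z : leib_sort,
    bracket (bracket x y) z = bracket (bracket x z) y + bracket x (bracket y z)
}.

Section PreDerivations.
Variables (K : fieldType) (L : leibnizAlgebra K).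

Definition pre_derivation (P : {linear L -> L}) : Prop :=
  forall x y z : L,
    P (bracket (bracket x y) z) =
      bracket (bracket (P x) y) z + bracket (bracket x (P y)) z
      + bracket (bracket x y) (P z).

Definition nilpotent_map (f : L -> L) : Prop :=
  exists k : nat, forall x : L, iter k f x = 0.

Definition strongly_nilpotent : Prop :=
  forall P : {linear L -> L}, pre_derivation P -> nilpotent_map P.

Definition non_strongly_nilpotent : Prop := ~ strongly_nilpotent.

End PreDerivations.

Section F1.
Variables (K : fieldType) (n : nat) (alpha : nat -> K) (theta : K).

(* The parameters are alpha 4, ..., alpha n and theta; the other values of
   alpha do not occur in the products.
   Basis vectors keep their 1-based numbering e_1, ..., e_n; the vector is 0
   for an index outside that range. *)
Definition F1_basis (i : nat) : 'rV[K]_n := \row_(k < n) (k.+1 == i)%:R.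

Local Notation e := F1_basis.

(* [e_i, e_j] *)
Definition F1_prod (i j : nat) : 'rV[K]_n :=
  if j == 1%N then
    if i == 1%N then e 3
    else if (2 <= i <= n - 1)%N then e i.+1 else 0
  else if j == 2%N then
    if i == 1%N then \sum_(4 <= t < n) alpha t *: e t + theta *: e n
    else if (2 <= i <= n - 2)%N then
      \sum_(i + 2 <= t < n.+1) alpha (t - i + 2)%N *: e t
    else 0
  else 0.

Definition F1_bracket (x y : 'rV[K]_n) : 'rV[K]_n :=
  \sum_(i < n) \sum_(j < n) (x 0 i * y 0 j) *: F1_prod i.+1 j.+1.

Lemma F1_bracket_linearl (a : K) (x y z : 'rV[K]_n) :
  F1_bracket (a *: x + y) z = a *: F1_bracket x z + F1_bracket y z.
Proof.
rewrite /F1_bracket scaler_sumr -big_split; apply: eq_bigr => i _ /=.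
rewrite scaler_sumr -big_split; apply: eq_bigr => j _ /=.
by rewrite !mxE scalerA -scalerDl mulrDl mulrA.
Qed.

Lemma F1_bracket_linearr (a : K) (x y z : 'rV[K]_n) :
  F1_bracket x (a *: y + z) = a *: F1_bracket x y + F1_bracket x z.
Proof.
rewrite /F1_bracket scaler_sumr -big_split; apply: eq_bigr => i _ /=.
rewrite scaler_sumr -big_split; apply: eq_bigr => j _ /=.
by rewrite !mxE scalerA -scalerDl mulrDr mulrCA.
Qed.

Lemma F1_bracket_suml (I : Type) (r : seq I) (P : pred I) (a : I -> K)
    (u : I -> 'rV[K]_n) (y : 'rV[K]_n) :
  F1_bracket (\sum_(i <- r | P i) a i *: u i) y =
    \sum_(i <- r | P i) a i *: F1_bracket (u i) y.
Proof.
apply: (big_rec2 (fun v w => F1_bracket v y = w)) => [|i v w _ <-].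
  by have := F1_bracket_linearl (-1) 0 0 y; rewrite scaler0 addr0 scaleN1r addNr.
by rewrite F1_bracket_linearl.
Qed.

Lemma F1_bracket_sumr (I : Type) (r : seq I) (P : pred I) (a : I -> K)
    (u : I -> 'rV[K]_n) (x : 'rV[K]_n) :
  F1_bracket x (\sum_(i <- r | P i) a i *: u i) =
    \sum_(i <- r | P i) a i *: F1_bracket x (u i).
Proof.
apply: (big_rec2 (fun v w => F1_bracket x v = w)) => [|i v w _ <-].
  by have := F1_bracket_linearr (-1) x 0 0; rewrite scaler0 addr0 scaleN1r addNr.
by rewrite F1_bracket_linearr.
Qed.

Lemma F1_basis_expand (x : 'rV[K]_n) : x = \sum_(i < n) x 0 i *: e i.+1.
Proof.
apply/rowP=> k; rewrite summxE (bigD1 k) //= !mxE eqxx mulr1 big1 ?addr0 //.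
by move=> i neq_ik; rewrite !mxE eqSS eq_sym (negPf (neq_ik : (i : nat) != k)) mulr0.
Qed.

Lemma F1_basis_gt (i : nat) : (n < i)%N -> e i = 0.
Proof.
move=> lt_ni; apply/rowP=> k; rewrite !mxE; case: eqP => // def_i.
by have := ltn_ord k; rewrite ltnNge -ltnS def_i lt_ni.
Qed.

Lemma F1_bracket_basis (i j : nat) : (0 < i <= n)%N -> (0 < j <= n)%N ->
  F1_bracket (e i) (e j) = F1_prod i j.
Proof.
case: i j => [|i] [|j] //= lt_in lt_jn; rewrite /F1_bracket.
rewrite (bigD1 (Ordinal lt_in)) //= (bigD1 (Ordinal lt_jn)) //= !mxE !eqxx mulr1.
rewrite scale1r big1 ?big1 ?addr0 // => [k|k] neq_k.
  rewrite big1 // => l _; rewrite !mxE eqSS.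
  by rewrite (negPf (neq_k : (k : nat) != i)) mul0r scale0r.
by rewrite !mxE eqSS (negPf (neq_k : (k : nat) != j)) mulr0 scale0r.
Qed.

Lemma F1_basis0 (i : nat) (y : 'rV[K]_n) : (n < i)%N -> F1_bracket (e i) y = 0.
Proof.
move/F1_basis_gt->; rewrite /F1_bracket big1 // => k _; rewrite big1 // => l _.
by rewrite mxE mul0r scale0r.
Qed.

Lemma F1_bracket_basis1 (i : nat) :
  (0 < n)%N -> (2 <= i)%N -> F1_bracket (e i) (e 1) = e i.+1.
Proof.
move=> n_gt0 i_ge2; have [lt_ni | le_in] := ltnP n i.
  by rewrite F1_basis0 // F1_basis_gt // ltnW.
rewrite F1_bracket_basis ?n_gt0 ?le_in ?andbT //; last by rewrite ltnW.
rewrite /F1_prod eqxx ifF; last by lia.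
by case: ifP => // i_out; rewrite F1_basis_gt //; lia.
Qed.

Lemma F1_bracket_basis2 (i : nat) : (2 <= n)%N -> (2 <= i)%N ->
  F1_bracket (e i) (e 2) =
    \sum_(i + 2 <= t < n.+1) alpha (t - i + 2)%N *: e t.
Proof.
move=> n_ge2 i_ge2; have [lt_ni | le_in] := ltnP n i.
  by rewrite F1_basis0 // big_geq // addn2 ltnS ltnW // ltnW.
rewrite F1_bracket_basis ?n_ge2 ?le_in ?andbT //; last by rewrite ltnW.
rewrite /F1_prod /= ifF; last by lia.
by case: ifP => // i_out; rewrite big_geq //; lia.
Qed.

Lemma F1_bracket_basis_ge3 (x : 'rV[K]_n) (j : nat) : (3 <= j <= n)%N ->
  F1_bracket x (e j) = 0.
Proof.
move=> j_bound; rewrite (F1_basis_expand x) F1_bracket_suml big1 // => i _.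
rewrite F1_bracket_basis ?ltn_ord //; last by lia.
by rewrite /F1_prod !ifF ?scaler0 //; lia.
Qed.

Lemma F1_bracket_basis12 (i : nat) : (3 <= n)%N -> (0 < i <= n)%N ->
  F1_bracket (F1_bracket (e i) (e 1)) (e 2) =
    F1_bracket (F1_bracket (e i) (e 2)) (e 1).
Proof.
move=> n_ge3 /andP[i_gt0 le_in]; have n_gt0 : (0 < n)%N by lia.
have [i_le1 | i_ge2] := leqP i 1.
  have -> : i = 1%N by lia.
  have -> : F1_bracket (e 1) (e 1) = e 3 by rewrite F1_bracket_basis // n_gt0.
  have -> : F1_bracket (e 1) (e 2) =
      theta *: e n + \sum_(4 <= t < n) alpha t *: e t.
    by rewrite F1_bracket_basis 1?addrC //; lia.
  rewrite F1_bracket_basis2 //; last by lia.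
  rewrite F1_bracket_linearl F1_bracket_suml F1_bracket_basis1 //; last by lia.
  rewrite F1_basis_gt // scaler0 add0r big_add1 /= !big_nat.
  apply: eq_bigr => t t_bound; rewrite F1_bracket_basis1 //; last by lia.
  by congr (alpha _ *: _); lia.
rewrite F1_bracket_basis1 // !F1_bracket_basis2 //; try by lia.
rewrite F1_bracket_suml addSn big_add1 /=.
have [le_i2n | lt_ni2] := leqP (i + 2) n; last by rewrite !big_geq //; lia.
rewrite [RHS]big_nat_recr //= F1_bracket_basis1 //; last by lia.
rewrite (F1_basis_gt (ltnSn n)) scaler0 addr0.
rewrite !big_nat; apply: eq_bigr => t t_bound.
by rewrite F1_bracket_basis1 ?subSS //; lia.
Qed.

Lemma F1_bracket_basis_comm (i j k : nat) : (3 <= n)%N ->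
  (0 < i <= n)%N -> (0 < j <= n)%N -> (0 < k <= n)%N ->
  F1_bracket (F1_bracket (e i) (e j)) (e k) =
    F1_bracket (F1_bracket (e i) (e k)) (e j).
Proof.
move=> n_ge3 i_bound.
have br0 y : F1_bracket 0 y = 0.
  by have := F1_bracket_linearl (-1) 0 0 y; rewrite scaler0 addr0 scaleN1r addNr.
wlog le_jk : j k / (j <= k)%N => [wl j_bound k_bound | j_bound k_bound].
  by have [/wl-> // | /ltnW/wl->] := leqP j k.
have [k_ge3 | k_lt3] := leqP 3 k.
  by rewrite !(@F1_bracket_basis_ge3 _ k) ?br0 //; lia.
have [-> // | neq_jk] := eqVneq j k.
have -> : j = 1%N by lia.
have -> : k = 2%N by lia.
exact: F1_bracket_basis12.
Qed.

Lemma F1_bracket_comm (x y z : 'rV[K]_n) : (3 <= n)%N ->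
  F1_bracket (F1_bracket x y) z = F1_bracket (F1_bracket x z) y.
Proof.
move=> n_ge3.
have expand2 u v : F1_bracket (F1_bracket x u) v =
    \sum_(j < n) \sum_(k < n) (u 0 j * v 0 k) *:
      F1_bracket (F1_bracket x (e j.+1)) (e k.+1).
  rewrite {1}[u]F1_basis_expand F1_bracket_sumr F1_bracket_suml.
  apply: eq_bigr => j _; rewrite {1}[v]F1_basis_expand F1_bracket_sumr.
  by rewrite scaler_sumr; apply: eq_bigr => k _; rewrite scalerA.
rewrite !expand2 exchange_big /=; apply: eq_bigr => j _; apply: eq_bigr => k _.
rewrite mulrC; congr (_ *: _).
rewrite [x]F1_basis_expand !F1_bracket_suml; apply: eq_bigr => i _.
by rewrite F1_bracket_basis_comm ?ltn_ord.
Qed.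

Lemma F1_bracket_bracketr (x y z : 'rV[K]_n) : (3 <= n)%N ->
  F1_bracket x (F1_bracket y z) = 0.
Proof.
move=> n_ge3; rewrite [F1_bracket y z]F1_basis_expand F1_bracket_sumr big1 // => k _.
have [k_ge2 | k_lt2] := leqP 2 k.
  by rewrite F1_bracket_basis_ge3 ?scaler0 // ltnS k_ge2 ltn_ord.
rewrite [_ 0 k](_ : _ = 0) ?scale0r // /F1_bracket summxE big1 // => i _.
rewrite summxE big1 // => j _; rewrite mxE.
suff -> : F1_prod i.+1 j.+1 0 k = 0 by rewrite mulr0.
have e0 t : (3 <= t)%N -> e t 0 k = 0.
  by move=> t_ge3; rewrite mxE; case: eqP => //; lia.
have sum0 a b (c : nat -> K) : (3 <= a)%N ->
    (\sum_(a <= t < b) c t *: e t) 0 k = 0.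
  move=> a_ge3; rewrite summxE big_nat big1 // => t t_bound.
  by rewrite mxE e0 ?mulr0 //; lia.
rewrite /F1_prod; case: ifP => _.
  case: ifP => [_|i_neq]; first by rewrite e0.
  by case: ifP => _; [rewrite e0 //; lia | rewrite mxE].
case: ifP => _; last by rewrite mxE.
case: ifP => _; first by rewrite mxE sum0 // add0r mxE e0 ?mulr0.
by case: ifP => i_bound; [rewrite sum0 //; lia | rewrite mxE].
Qed.

Lemma F1_bracket_leibniz (x y z : 'rV[K]_n) : (3 <= n)%N ->
  F1_bracket (F1_bracket x y) z =
    F1_bracket (F1_bracket x z) y + F1_bracket x (F1_bracket y z).
Proof.
by move=> n_ge3; rewrite F1_bracket_comm // F1_bracket_bracketr // addr0.
Qed.

End F1.

(* The Leibniz identity fails for n = 2 and theta <> 0, hence the bound on n. *)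
Definition F1 (K : fieldType) (n : nat) (hn : (4 <= n)%N)
    (alpha : nat -> K) (theta : K) : leibnizAlgebra K :=
  @LeibnizAlgebra K 'rV[K]_n (F1_bracket alpha theta)
    (F1_bracket_linearl alpha theta) (F1_bracket_linearr alpha theta)
    (fun x y z => F1_bracket_leibniz alpha theta x y z (ltnW hn)).

(* The p-th Catalan number C^p_m, for p >= 1 and K of characteristic 0. *)
Definition pCatalan (K : fieldType) (p m : nat) : K :=
  'C(p * m, m)%:R / ((p - 1) * m + 1)%:R.

(* Main.v *)
(* Modulo the line spanned by e_1 - e_2, the algebra is K[X]/X^(n-1) with e_i
   standing for X^(i-2); right multiplication by e_1 is multiplication by X, and
   right multiplication by e_2 is multiplication by
   A = alpha_4 X^2 + alpha_5 X^3 + ... The products [[x,e_1],e_1] force a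
   pre-derivation P to act on polynomials as
     p |-> C p' + u p - w (p - p(-X)),  C = a_1 X + a_2 A,
   where P e_1 = a_1 e_1 + a_2 e_2 + ... The products involving e_2 then give
     C A' = b A  and  w (A + A(-X)) = 0  mod X^(n-3),  b = a_1 + a_2.
   If the even part of A vanishes mod X^(n-3), which is case iii), w is free and
   P may be a projection onto odd powers. Otherwise w(0) = 0 and P is triangular
   with eigenvalues governed by a_1 and a_2. Comparing lowest terms in C A' = b A
   gives b = m a_1 with m the order of A, so P is nilpotent unless a_1 <> 0, in
   which case
     (X + (m-1) A) A' = m A  mod X^(n-3).
   The solutions of this equation with lowest term a X^m are the Fuss-Catalan
   series of cases i) (m = 2) and ii) (m = 2s - 2). *)

From HB Require Import structures.
Require Import Defs.
From mathcomp Require Import all_boot all_order all_algebra.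
From mathcomp Require Import zify ring.
From mathcomp Require Import reals complex.
From Stdlib Require Import Classical_Prop.

Set Implicit Arguments.
Unset Strict Implicit.
Unset Printing Implicit Defensive.

Import GRing.Theory Num.Theory.
Local Open Scope ring_scope.

(** * Fuss-Catalan series *)

Section Rothe.
Variables (K : numFieldType) (p : nat).

(** Coefficient of z^k in B^x, where B = 1 + z B^p is the generalised binomial series. The case k =
    0 is separate because at x = 0 the formula would read 0/0, which evaluates to 0 instead of 1. *)
Definition rothe (k x : nat) : K :=
  if k == 0%N then 1 else x%:R / (x + p * k)%:R * 'C(x + p * k, k)%:R.

Lemma rotheE k x : (0 < x + p * k)%N ->
  rothe k x = x%:R / (x + p * k)%:R * 'C(x + p * k, k)%:R.
Proof.
rewrite /rothe; case: k => [|k] //=; rewrite muln0 addn0 => x_gt0.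
by rewrite bin0 mulr1 divff // pnatr_eq0 -lt0n.
Qed.

(** Coefficient form of B^(x+1) = B^x + z B^(x+p). With N = x + p (k+1), both terms on the right are
    multiples of the binomial coefficient of N+1 over k+1; comparing factors leaves the identity
    [Nk]. *)
Lemma rotheS k x : (0 < p)%N ->
  rothe k.+1 x.+1 = rothe k.+1 x + rothe k (x + p).
Proof.
move=> p_gt0; rewrite !rotheE; try by lia.
have -> : (x + p + p * k = x + p * k.+1)%N by lia.
have -> : (x.+1 + p * k.+1 = (x + p * k.+1).+1)%N by lia.
have defN : (x + p * k.+1)%:R = x%:R + p%:R * k.+1%:R :> K by rewrite natrD natrM.
have N_gt0 : (0 < x + p * k.+1)%N by lia.
have N_ge : (k <= x + p * k.+1)%N by nia.
set N := (x + p * k.+1)%N in defN N_gt0 N_ge *.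
have binl : N.+1%:R * 'C(N, k)%:R = k.+1%:R * 'C(N.+1, k.+1)%:R :> K.
  by rewrite -!natrM mul_bin_diag.
have binr : N.+1%:R * 'C(N, k.+1)%:R = (N%:R - k%:R) * 'C(N.+1, k.+1)%:R :> K.
  by rewrite -natrB // -!natrM -[N in LHS]/(N.+1.-1) mul_bin_down subSS.
have N0 : N%:R != 0 :> K by rewrite pnatr_eq0 -lt0n.
have N1 : N.+1%:R != 0 :> K by rewrite pnatr_eq0.
apply: (mulfI N1); rewrite mulrDr.
have -> : N.+1%:R * (x%:R / N%:R * 'C(N, k.+1)%:R) =
  x%:R / N%:R * ((N%:R - k%:R) * 'C(N.+1, k.+1)%:R) :> K by rewrite -binr; ring.
have -> : N.+1%:R * ((x + p)%:R / N%:R * 'C(N, k)%:R) =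
  (x + p)%:R / N%:R * (k.+1%:R * 'C(N.+1, k.+1)%:R) :> K by rewrite -binl; ring.
rewrite natrD -[x.+1%:R]natr1 -[k.+1%:R]natr1.
have Nk : x%:R * (N%:R - k%:R) + (x%:R + p%:R) * (k%:R + 1) = (x%:R + 1) * N%:R :> K.
  by rewrite defN -[k.+1%:R]natr1; ring.
move: N%:R N.+1%:R 'C(_, _)%:R N0 N1 Nk => a b c a0 b0 Nk.
transitivity ((x%:R + 1) * c); first by field.
by apply: (mulfI a0); rewrite [a * _]mulrA [a * (_ + _)]mulrC -Nk; field.
Qed.

Lemma rothe0 k : rothe k 0 = (k == 0%N)%:R.
Proof. by rewrite /rothe; case: eqP => // _; rewrite !mul0r. Qed.

(* Both sides agree at x = 0, and by rotheS their differences in x are the two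
   sides of the identity for k - 1. *)
Lemma rothe_conv k x y : (0 < p)%N ->
  \sum_(i < k.+1) rothe i x * rothe (k - i) y = rothe k (x + y).
Proof.
move=> p_gt0; elim: k x => [|k IHk] x.
  by rewrite big_ord1 /rothe /= mulr1.
elim: x => [|x IHx].
  rewrite big_ord_recl /= rothe0 eqxx mul1r subn0 big1 ?addr0 // => i _.
  by rewrite rothe0 mul0r.
rewrite addSn rotheS // -IHx addnAC -IHk.
rewrite big_ord_recl [in RHS]big_ord_recl -addrA; congr (_ + _).
rewrite -big_split; apply: eq_bigr => i _ /=.
by rewrite rotheS // mulrDl subSS.
Qed.

Lemma pCatalan_rothe k : (0 < p)%N -> pCatalan K p k = rothe k 1.
Proof.
move=> p_gt0; rewrite rotheE ?add1n // /pCatalan mul1r.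
have := mul_bin_down (p * k).+1 k; rewrite /=.
rewrite (_ : (p * k).+1 - k = (p - 1) * k + 1)%N; last by nia.
move/(congr1 (fun i => i%:R : K)); rewrite !natrM => def_bin.
have N0 : (p * k).+1%:R != 0 :> K by rewrite pnatr_eq0.
have N1 : ((p - 1) * k + 1)%:R != 0 :> K by rewrite pnatr_eq0 addn1.
by rewrite [RHS]mulrC; apply/eqP; rewrite eqr_div // mulrC def_bin mulrC.
Qed.

(** Relates the coefficients of B^2 to those of B, so that a quadratic equation in B can be checked
    coefficientwise. *)
Lemma rothe2 k : (0 < p)%N ->
  ((p.-1 * k).+2)%:R * rothe k 2 = 2 * ((p * k).+1)%:R * rothe k 1.
Proof.
move=> p_gt0; rewrite !rotheE // !addSn add0n mul1r.
have := mul_bin_down (p * k).+2 k; rewrite /=.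
rewrite (_ : (p * k).+2 - k = (p.-1 * k).+2)%N; last by nia.
move/(congr1 (fun i => i%:R : K)); rewrite !natrM => def_bin.
have N0 : (p * k).+1%:R != 0 :> K by rewrite pnatr_eq0.
have N1 : (p * k).+2%:R != 0 :> K by rewrite pnatr_eq0.
move: (p * k).+1%:R (p * k).+2%:R 'C(_, _)%:R 'C(_, _)%:R (p.-1 * k).+2%:R N0 N1 def_bin.
by move=> a b c d f a0 b0 def_bin; rewrite mulrCA -def_bin; field; rewrite a0.
Qed.

End Rothe.

(** * Congruences modulo powers of X *)

Section Divisibility.
Variable K : fieldType.
Implicit Types (p q : {poly K}).

Lemma dvdXnP d p : reflect (forall i, (i < d)%N -> p`_i = 0) ('X^d %| p).
Proof.
apply: (iffP idP) => [/dvdpP[q ->] i lt_id | p0]; first by rewrite coefMXn lt_id.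
rewrite -[p](poly_take_drop d) (_ : take_poly d p = 0) ?add0r ?dvdp_mulIr //.
by apply/polyP=> i; rewrite coef_take_poly coef0; case: ifP => // /p0.
Qed.

End Divisibility.

(** * The differential equation of the Catalan series *)

Section CatalanSeries.
Variables (K : numFieldType).

(* Up to rescaling of X, the nonzero solutions of order m >= 2 of this
   equation are X (1 - G(X^(m-1))), with G the generating series of the m-th
   Catalan numbers. *)
Definition catalan_ode (m : nat) (A : {poly K}) : {poly K} :=
  ('X + m.-1%:R * A) * A^`() - m%:R * A.

(** Truncation modulo X^d of G(b X), where G = 1 + X G^p. *)
Definition catalan_gf (p d : nat) (b : K) : {poly K} :=
  \poly_(k < d) (rothe K p k 1 * b ^+ k).

Lemma catalan_gf_sqr p d b k : (0 < p)%N -> (k < d)%N ->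
  (catalan_gf p d b * catalan_gf p d b)`_k = rothe K p k 2 * b ^+ k.
Proof.
move=> p_gt0 lt_kd; rewrite coefM -(@rothe_conv K p k 1 1) // mulr_suml.
apply: eq_bigr => i _; have le_ik : (i <= k)%N by rewrite -ltnS ltn_ord.
rewrite !coef_poly (leq_ltn_trans le_ik) // (leq_ltn_trans (leq_subr _ _)) //.
have -> : b ^+ k = b ^+ i * b ^+ (k - i) by rewrite -exprD subnKC.
by ring.
Qed.

(** Differentiating G = 1 + X G^p and eliminating G^p suggests this equation. Since 2 G G' = (G^2)',
    twice the polynomial is linear in G, G^2 and their derivatives, and coefficientwise it reduces
    to [rothe2]. *)
Lemma catalan_gf_ode p d b (G := catalan_gf p d b) : (0 < p)%N ->
  'X^d %| 'X * G^`() * (p%:R - p.-1%:R * G) - G * (G - 1).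
Proof.
move=> p_gt0; apply/dvdXnP => k lt_kd.
have n2 : 2 != 0 :> K by rewrite pnatr_eq0.
have dG2 : (G * G)^`() = 2 * (G^`() * G) by rewrite derivM; ring.
apply: (mulfI n2); rewrite mulr0 -coefCM.
have -> : 2%:P * ('X * G^`() * (p%:R - p.-1%:R * G) - G * (G - 1)) =
   (2 * p%:R)%:P * ('X * G^`()) - p.-1%:R%:P * ('X * (G * G)^`())
   - 2%:P * (G * G) + 2%:P * G.
  by rewrite dG2 !polyCM !rmorph_nat; ring.
rewrite !(coefD, coefN, coefCM) catalan_gf_sqr // !coefXM.
have coXD (q : {poly K}) : (if k == 0%N then 0 else q^`()`_k.-1) = k%:R * q`_k.
  by case: k {lt_kd} => [|k]; rewrite ?mul0r // coef_deriv /= mulr_natl.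
rewrite !coXD catalan_gf_sqr // coef_poly lt_kd.
have := rothe2 K k p_gt0; set r2 := rothe K p k 2; set r1 := rothe K p k 1.
rewrite -[(p.-1 * k).+2]addn2 -[(p * k).+1]addn1 !natrD !natrM => r21.
transitivity ((2 * (p%:R * k%:R + 1%:R) * r1 - (p.-1%:R * k%:R + 2%:R) * r2) * b ^+ k).
  by ring.
by rewrite r21 subrr mul0r.
Qed.

(** The argument [- a] makes a the coefficient of X^m, as G has linear coefficient 1. *)
Definition catalan_poly (m d : nat) (a : K) : {poly K} :=
  'X * (1 - (catalan_gf m d (- a) \Po 'X^(m.-1))).

(** Substituting X^(m-1) in [catalan_gf_ode] and multiplying by -(m-1) X gives the equation for X (1
    - G). *)
Lemma catalan_poly_ode m d a : (1 < m)%N -> 'X^d %| catalan_ode m (catalan_poly m d a).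
Proof.
move=> m_gt1; set G := catalan_gf m d (- a).
have m_gt0 : (0 < m)%N by lia.
have := catalan_gf_ode d (- a) m_gt0; rewrite -/G.
case/dvdpP=> [q /(congr1 (comp_poly 'X^(m.-1)))].
rewrite rmorphM rmorphXn /= comp_polyX -exprM.
rewrite !(rmorphM, rmorphB, rmorph1, rmorph_nat) /= comp_polyX.
set GX := G \Po _; set G' := G^`() \Po _ => ode.
(* Multiplying the chain rule by X avoids the exponent m - 2. *)
have dGX : GX^`() * 'X = G' * (m.-1%:R * 'X^(m.-1)).
  rewrite /GX deriv_comp -/G' derivXn -mulr_natl.
  have -> : 'X^(m.-1) = 'X^(m.-1.-1) * 'X :> {poly K} by rewrite -exprSr prednK //; lia.
  by ring.
have -> : catalan_ode m (catalan_poly m d a) =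
  - (m.-1%:R * 'X * (q \Po 'X^(m.-1))) * 'X^(m.-1 * d).
  rewrite -[in RHS]mulNr -mulrA -ode /catalan_ode /catalan_poly -/G -/GX.
  rewrite derivM derivB derivX.
  rewrite -[1]/(1%:P) derivC sub0r polyC1.
  have -> : m%:R = m.-1%:R + 1 :> {poly K} by rewrite natr1 prednK.
  transitivity ('X * ((1 + m.-1%:R * (1 - GX)) * ((1 - GX) - GX^`() * 'X)
    - (m.-1%:R + 1) * (1 - GX))).
    ring.
  by rewrite dGX; ring.
by rewrite dvdp_mull // dvdp_exp2l //; nia.
Qed.

Lemma catalan_poly_coef m d a t : (1 < m)%N -> (0 < t < d)%N ->
  (catalan_poly m d a)`_(m.-1 * t).+1 = (-1) ^+ t.+1 * pCatalan K m t * a ^+ t.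
Proof.
move=> m_gt1 /andP[t_gt0 lt_td]; have m_gt0 : (0 < m)%N by lia.
rewrite coefXM /= coefB coef1 coef_comp_poly_Xn; last by lia.
rewrite dvdn_mulr // mulKn; last by lia.
rewrite coef_poly lt_td (_ : (_ == 0)%N = false); last by nia.
by rewrite pCatalan_rothe // sub0r [(- a) ^+ t]exprNn exprS; ring.
Qed.

Lemma catalan_poly_coef0 m d a k : (1 < m)%N -> (0 < d)%N ->
  ~ (exists t, (0 < t)%N /\ k = (m.-1 * t).+1) -> (catalan_poly m d a)`_k = 0.
Proof.
move=> m_gt1 d_gt0 k_out; rewrite coefXM; case: k k_out => //= k k_out.
rewrite coefB coef1 coef_comp_poly_Xn; last by lia.
have [/dvdnP[t def_k] | ] := boolP (m.-1 %| k)%N; last first.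
  by case: k {k_out} => [|k _]; rewrite ?dvdn0 ?subr0.
have t0 : t = 0%N.
  case: t def_k => // t def_k; case: k_out; exists t.+1.
  by rewrite mulnC def_k.
rewrite def_k t0 mul0n div0n eqxx coef_poly d_gt0.
by rewrite /rothe /= mul1r expr0 subrr.
Qed.

(** Induction on the degree k. Once X^k divides A - B with k > m, the coefficient of X^k in the
    difference of the two equations is k - m times that of A - B, and k - m is invertible in
    characteristic 0. *)
Lemma catalan_ode_uniq m d (A B : {poly K}) : (1 < m)%N ->
  'X^m %| A -> 'X^m %| B -> A`_m = B`_m ->
  'X^d %| catalan_ode m A -> 'X^d %| catalan_ode m B -> 'X^d %| A - B.
Proof.
move=> m_gt1 mA mB ABm odeA odeB; apply/dvdXnP => k.
(* As A and B are multiples of X^2, the nonlinear terms contribute only above degree k. *)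
have [r defA] : exists r, A = r * 'X^2 by apply/dvdpP/(dvdp_trans _ mA)/dvdp_exp2l.
have [s defB] : exists s, B = s * 'X^2 by apply/dvdpP/(dvdp_trans _ mB)/dvdp_exp2l.
elim/ltn_ind: k => k IHk lt_kd.
have [le_km | lt_mk] := leqP k m.
  move: le_km; rewrite leq_eqVlt => /predU1P[->|lt_km]; first by rewrite coefB ABm subrr.
  by rewrite coefB (dvdXnP _ _ mA) // (dvdXnP _ _ mB) // subrr.
have /dvdpP[D defAB] : 'X^k %| A - B.
  by apply/dvdXnP=> i lt_ik; apply: IHk => //; apply: ltn_trans lt_kd.
have := dvdp_sub odeA odeB.
have -> : catalan_ode m A - catalan_ode m B =
  ('X + m.-1%:R * A) * (A - B)^`() + m.-1%:R * (A - B) * B^`() - m%:R * (A - B).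
  by rewrite /catalan_ode derivB; ring.
have -> : ('X + m.-1%:R * A) * (A - B)^`() + m.-1%:R * (A - B) * B^`()
    - m%:R * (A - B) =
  ('X * (D^`() + m.-1%:R * r * D^`() * 'X + m.-1%:R * r * (k%:R * D)
   + m.-1%:R * D * (s^`() * 'X + 2 * s)) + (k%:R - m%:R) * D) * 'X^k.
  rewrite defAB {1}defA defB !derivM derivXn derivX.
  have -> : 'X^k = 'X^(k.-1) * 'X :> {poly K} by rewrite -exprSr prednK //; lia.
  by move: 'X^(k.-1) => Y; rewrite -(mulr_natl Y); ring.
move/dvdXnP/(_ k lt_kd); rewrite defAB !coefMXn ltnn subnn coefD coefXM /= add0r.
rewrite -natrB ?mulr_natl ?coefMn; last by lia.
by move/eqP; rewrite mulrn_eq0 subn_eq0 leqNgt lt_mk => /eqP.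
Qed.

Lemma catalan_poly_lead m d a : (1 < m)%N -> (1 < d)%N ->
  (catalan_poly m d a)`_m = a.
Proof.
move=> m_gt1 d_gt1; have := catalan_poly_coef (t := 1) a m_gt1 d_gt1.
rewrite muln1 prednK; last by lia.
move->; rewrite /pCatalan !muln1 bin1 addn1 subn1 prednK ?divff ?mulr1; try by lia.
  by rewrite expr2 mulrNN !mul1r expr1.
by rewrite pnatr_eq0; lia.
Qed.

Lemma dvdXn_catalan_poly m d a : (1 < m)%N -> (0 < d)%N ->
  'X^m %| catalan_poly m d a.
Proof.
move=> m_gt1 d_gt0; apply/dvdXnP => i lt_im.
apply: catalan_poly_coef0 => // -[t [t_gt0 def_i]].
by move: lt_im; rewrite def_i; nia.
Qed.

(** Truncating at d + 2 rather than d keeps the leading coefficient of the Catalan polynomial even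
    when d < 2. *)
Lemma catalan_ode_sol m d (A : {poly K}) : (1 < m)%N -> 'X^m %| A ->
  'X^d %| catalan_ode m A -> 'X^d %| A - catalan_poly m d.+2 A`_m.
Proof.
move=> m_gt1 dvA ode; apply: (catalan_ode_uniq m_gt1 dvA) => //.
- exact: dvdXn_catalan_poly.
- by rewrite catalan_poly_lead.
- by rewrite (dvdp_trans _ (catalan_poly_ode _ _ m_gt1)) // dvdp_exp2l // leqW.
Qed.

(** Changing A by a multiple of X^d changes the equation by a multiple of X^d: differentiation loses
    one power of X, which the factor X or A restores. *)
Lemma catalan_poly_dvd_ode m d e (A : {poly K}) a : (1 < m)%N -> (d <= e)%N ->
  (0 < e)%N -> 'X^m %| A -> 'X^d %| A - catalan_poly m e a ->
  'X^d %| catalan_ode m A.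
Proof.
move=> m_gt1 le_de e_gt0 dvA; set B := catalan_poly m e a => dvAB.
have [r defA] : exists r, A = r * 'X.
  apply/dvdpP; apply: dvdp_trans dvA; rewrite -[X in X %| _]expr1 dvdp_exp2l //; lia.
have dvB : 'X^d %| catalan_ode m B.
  by rewrite (dvdp_trans _ (catalan_poly_ode _ _ m_gt1)) // dvdp_exp2l.
have -> : catalan_ode m A = catalan_ode m B +
  (('X * (A - B)^`()) * (1 + m.-1%:R * r) + (A - B) * (m.-1%:R * B^`() - m%:R)).
  by rewrite /catalan_ode derivB {1}defA; ring: defA.
apply: dvdp_add => //; apply: dvdp_add; last exact: dvdp_mulr.
apply: dvdp_mulr; apply/dvdXnP => -[|i] lt_id; rewrite coefXM //= coef_deriv.
by rewrite (dvdXnP _ _ dvAB) // mul0rn.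
Qed.

End CatalanSeries.

(** * The algebra as a polynomial ring *)

Section Model.
Variables (K : fieldType) (N : nat).
Local Notation n := N.+4.
Implicit Types (x y z : 'rV[K]_n) (p q : {poly K}).

(* x is encoded by its e_1-coordinate and by pol x in K[X]/X^(n-1), where
   e_1 |-> 1 and e_i |-> X^(i-2) for i >= 2; mvec is the inverse of pol on the
   span of e_2, ..., e_n. Coordinates are numbered from 0. *)
Definition co x k : K := x 0 (inord k).

Definition pol x : {poly K} := \sum_(i < n) x 0 i *: 'X^(i.-1).

Definition mvec p : 'rV[K]_n := \row_i (p`_i.-1 *+ (0 < i)).

Lemma co_linear a x y k : co (a *: x + y) k = a * co x k + co y k.
Proof. by rewrite /co !mxE. Qed.

Lemma coE x (i : 'I_n) : co x i = x 0 i.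
Proof. by rewrite /co inord_val. Qed.

Lemma co_basis i k : (k < n)%N -> co (F1_basis K n i) k = (k.+1 == i)%:R.
Proof. by move=> lt_kn; rewrite /co mxE inordK. Qed.

Lemma co_mvec p k : (k < n)%N -> co (mvec p) k = p`_k.-1 *+ (0 < k).
Proof. by move=> lt_kn; rewrite /co mxE inordK. Qed.

Lemma co_inj x y : (forall k, (k < n)%N -> co x k = co y k) -> x = y.
Proof. by move=> eq_xy; apply/rowP=> i; rewrite -!coE eq_xy. Qed.

Fact pol_is_linear : linear pol.
Proof.
move=> a x y; rewrite /pol scaler_sumr -big_split; apply: eq_bigr => i _ /=.
by rewrite !mxE scalerDl scalerA.
Qed.
HB.instance Definition _ :=
  GRing.isLinear.Build K 'rV[K]_n {poly K} _ pol pol_is_linear.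

Fact mvec_is_linear : linear mvec.
Proof.
by move=> a p q; apply/rowP=> i; rewrite !mxE coefD coefZ mulrnDl mulrnAr.
Qed.
HB.instance Definition _ :=
  GRing.isLinear.Build K {poly K} 'rV[K]_n _ mvec mvec_is_linear.

Lemma pol_coef0 x : (pol x)`_0 = co x 0 + co x 1.
Proof.
rewrite coef_sum 2!big_ord_recl big1 ?addr0 => [|i _]; last first.
  by rewrite coefZ coefXn mulr0.
rewrite !coefZ !coefXn !mulr1 -!coE.
by congr (co x _ + co x _); apply: val_inj.
Qed.

Lemma pol_coefS x k : (k < N.+2)%N -> (pol x)`_k.+1 = co x k.+2.
Proof.
move=> lt_k; rewrite coef_sum.
have lt_kn : (k.+2 < n)%N by [].
rewrite (bigD1 (Ordinal lt_kn)) //= coefZ coefXn eqxx mulr1 -coE.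
rewrite big1 ?addr0 // => i neq_i; rewrite coefZ coefXn.
case: eqP => [def_i|]; rewrite ?mulr0 //; case/eqP: neq_i; apply/val_inj => /=.
by move: def_i; case: (nat_of_ord i) => // j /= ->.
Qed.

Lemma mvec_eq p q : 'X^(N.+3) %| p - q -> mvec p = mvec q.
Proof.
move/dvdXnP=> eq_pq; apply: co_inj => -[|k] lt_kn; rewrite !co_mvec //=.
by rewrite -[p](subrK q) coefD eq_pq // add0r.
Qed.

Lemma pol_mvec p : 'X^(N.+3) %| pol (mvec p) - p.
Proof.
apply/dvdXnP=> -[|k] lt_k; rewrite coefB.
  by rewrite pol_coef0 !co_mvec //= add0r subrr.
by rewrite pol_coefS // co_mvec //= subrr.
Qed.

Lemma mvecXn i : mvec 'X^i = F1_basis K n i.+2.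
Proof.
by apply: co_inj => -[|k] lt_kn; rewrite co_mvec // co_basis //= coefXn.
Qed.

Lemma pol_basis i : (i < n)%N -> pol (F1_basis K n i.+1) = 'X^(i.-1).
Proof.
move=> lt_in; rewrite /pol (bigD1 (Ordinal lt_in)) //= mxE eqxx scale1r.
rewrite big1 ?addr0 // => j neq_j.
by rewrite mxE eqSS (negPf (neq_j : (j : nat) != i)) scale0r.
Qed.

Variables (alpha : nat -> K) (theta : K).

Definition strA : {poly K} :=
  \poly_(k < N.+3) (if (2 <= k)%N then alpha k.+2 else 0).

(* On the span of e_2, ..., e_n, right multiplication by y is multiplication
   of polynomials by rmul_pol y. *)
Definition rmul_pol y : {poly K} := (co y 0)%:P * 'X + (co y 1)%:P * strA.

Local Notation lam := rmul_pol.
Local Notation br := (F1_bracket alpha theta).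

Lemma F1_prod1E i : F1_prod n alpha theta i.+1 1 = mvec ('X^(i.-1) * 'X).
Proof.
rewrite -exprSr mvecXn /F1_prod /=; case: i => [|i] //=.
by case: ifP => // /negbT i_out; rewrite F1_basis_gt //; lia.
Qed.

Lemma strA_sum : mvec strA = \sum_(4 <= t < n.+1) alpha t *: F1_basis K n t.
Proof.
rewrite /strA poly_def linear_sum /=.
rewrite 2!big_ord_recl !scale0r !raddf0 !add0r 4!big_add1 /= big_mkord.
by apply: eq_bigr => i _; rewrite linearZ /= mvecXn.
Qed.

(** Both e_1 and e_2 are encoded by 1, and their products with e_2 differ only in the coefficient of
    e_n: theta for e_1, alpha_n for e_2. The term in X^(N+2) records this. *)
Lemma F1_prod2E i :
  F1_prod n alpha theta i.+1 2 =
    mvec ('X^(i.-1) * strA + (theta - alpha n)%:P * 'X^(N.+2) *+ (i == 0%N)).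
Proof.
have [->|i_gt0] := posnP i.
  rewrite /F1_prod /= mul1r mulr1n mul_polyC linearD linearZ /= mvecXn strA_sum.
  by rewrite [in RHS]big_nat_recr //= scalerBl addrACA subrr addr0.
rewrite mulr0n addr0.
have -> : F1_prod n alpha theta i.+1 2 =
    \sum_(i.+3 <= t < n.+1) alpha (t - i.+1 + 2)%N *: F1_basis K n t.
  have i_neq1 : (i.+1 == 1%N) = false by lia.
  have [i_in | i_out] := boolP (2 <= i.+1 <= n - 2)%N.
    by rewrite /F1_prod i_neq1 i_in addn2.
  by rewrite /F1_prod i_neq1 (negPf i_out) big_geq //; lia.
apply: co_inj => k lt_kn; rewrite co_mvec // coefXnM coef_poly.
transitivity (\sum_(i.+3 <= t < n.+1) alpha (t - i.+1 + 2)%N * (k.+1 == t)%:R).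
  rewrite /co summxE; apply: eq_bigr => t _.
  by rewrite !mxE inordK.
have [le_ik | lt_ki] := leqP i.+2 k.
  rewrite (bigD1_seq k.+1) ?iota_uniq ?mem_index_iota //=; last by lia.
  rewrite eqxx mulr1 big1 ?addr0 => [|t neq_t]; last first.
    by rewrite eq_sym (negPf neq_t) mulr0.
  rewrite ifF; last by lia.
  rewrite !ifT; try by lia.
  by rewrite (_ : (0 < k)%N = true) ?mulr1n; [congr alpha | ]; lia.
rewrite big_nat big1 => [|t t_bound]; last first.
  by rewrite (_ : (k.+1 == t) = false) ?mulr0 //; lia.
case: ifP => [_|k_ge]; first by rewrite mul0rn.
by rewrite (_ : (1 < k.-1 - i.-1)%N = false) ?if_same ?mul0rn //; lia.
Qed.

Lemma F1_bracketE x y :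
  br x y = mvec (pol x * lam y
    + (co x 0 * co y 1 * (theta - alpha n))%:P * 'X^(N.+2)).
Proof.
have -> : br x y = \sum_(i < n) (x 0 i * co y 0) *: mvec ('X^(i.-1) * 'X)
  + \sum_(i < n) (x 0 i * co y 1) *: mvec ('X^(i.-1) * strA
      + (theta - alpha n)%:P * 'X^(N.+2) *+ (i == 0%N :> nat)).
  rewrite -big_split; apply: eq_bigr => i _.
  rewrite 2!big_ord_recl big1 ?addr0 => [|j _]; last by rewrite scaler0.
  rewrite -F1_prod1E -F1_prod2E -!coE.
  by congr (_ * co y _ *: _ + _ * co y _ *: _); apply: val_inj.
under eq_bigr do rewrite -linearZ /=.
under [X in _ + X]eq_bigr do rewrite -linearZ /=.
rewrite -!linear_sum -linearD; congr mvec.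
under [X in _ + X]eq_bigr do rewrite scalerDr.
rewrite big_split /= addrA; congr (_ + _).
  rewrite /pol big_distrl -big_split /=; apply: eq_bigr => i _.
  by rewrite /rmul_pol -!mul_polyC !polyCM; ring.
rewrite big_ord_recl big1 ?addr0 /= => [|i _]; last by rewrite mulr0n scaler0.
rewrite mulr1n -mul_polyC mulrA -polyCM -coE.
by congr ((co x _ * _ * _)%:P * _).
Qed.

Lemma lam_XE y : exists q, lam y = q * 'X.
Proof.
apply/dvdpP; rewrite -['X]expr1; apply/dvdXnP => -[|//] _.
by rewrite coefD !coefCM coefX coef_poly /= !mulr0 addr0.
Qed.

(** The theta-correction sits in the top degree N + 2 and [lam z] is a multiple of X, so triple
    products do not see theta. *)
Lemma F1_triple x y z : br (br x y) z = mvec (pol x * lam y * lam z).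
Proof.
rewrite F1_bracketE; apply: mvec_eq; set u := br x y.
have -> : co u 0 = 0 by rewrite /u F1_bracketE co_mvec.
rewrite !mul0r addr0 -mulrBl /u F1_bracketE.
set p := _ + _ * 'X^_; have := pol_mvec p; set r := pol (mvec p) => /dvdpP[s def_r].
have [q ->] := lam_XE z.
have -> : r - pol x * lam y = s * 'X^(N.+3) +
   (co x 0 * co y 1 * (theta - alpha n))%:P * 'X^(N.+2).
  by rewrite -def_r /p; ring.
rewrite mulrDl [X in _ + X](_ : _ =
  (co x 0 * co y 1 * (theta - alpha n))%:P * q * 'X^(N.+3)).
  by apply: dvdp_add; rewrite ?dvdp_mulIr // dvdp_mulr // dvdp_mulIr.
by rewrite [in RHS]exprS; ring.
Qed.

Lemma strA_coef_small k : (k < 2)%N -> strA`_k = 0.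
Proof. by move=> lt_k2; rewrite coef_poly (_ : (1 < k)%N = false) ?if_same //; lia. Qed.

Lemma strA_coef k : (2 <= k < N.+3)%N -> strA`_k = alpha k.+2.
Proof. by move=> /andP[k_ge2 lt_kN]; rewrite coef_poly lt_kN k_ge2. Qed.

Lemma strA_XX : exists r, strA = r * 'X^2.
Proof. by apply/dvdpP/dvdXnP => k; apply: strA_coef_small. Qed.

Lemma lam_e1 : lam (F1_basis K n 1) = 'X.
Proof. by rewrite /rmul_pol !co_basis // mul1r mul0r addr0. Qed.

Lemma lam_e2 : lam (F1_basis K n 2) = strA.
Proof. by rewrite /rmul_pol !co_basis // mul1r mul0r add0r. Qed.

Lemma lam_e3 i : lam (F1_basis K n i.+3) = 0.
Proof. by rewrite /rmul_pol !co_basis // !mul0r addr0. Qed.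

Lemma mvec1 : mvec 1 = F1_basis K n 2.
Proof. exact: (mvecXn 0). Qed.

Lemma mvecX : mvec 'X = F1_basis K n 3.
Proof. exact: (mvecXn 1). Qed.

End Model.

(** * Pre-derivations *)

Section Operators.
Variable K : fieldType.
Implicit Types (p q C u w : {poly K}).

Lemma coef_comp_polyNX p k : (p \Po - 'X)`_k = (-1) ^+ k * p`_k.
Proof.
elim/poly_ind: p k => [|p c IHp] k; first by rewrite comp_poly0 coef0 mulr0.
rewrite comp_poly_MXaddC mulrN !coefD coefN !coefMX !coefC.
by case: k => [|k]; rewrite /= ?oppr0 ?mul1r // !addr0 IHp exprS; ring.
Qed.

(* The general form of a linear map Q with Q (p X^2) = Q p X^2 + 2 p X C, up to
   the values of Q at 1 and X: the last term only sees the odd part of p. *)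
Definition qop C u w p := C * p^`() + u * p - w * (p - (p \Po - 'X)).

Fact qop_is_linear C u w : linear (qop C u w).
Proof.
move=> a p q; rewrite /qop linearP /= comp_polyD comp_polyZ -!mul_polyC; ring.
Qed.
HB.instance Definition _ C u w :=
  GRing.isLinear.Build K {poly K} {poly K} _ (qop C u w) (qop_is_linear C u w).

(** The last term vanishes for even q; the case q = X^2 is the relation coming from [[[x, e_1],
    e_1]]. *)
Lemma qopM C u w p q :
  qop C u w (p * q) = qop C u w p * q + p * (C * q^`())
    - w * (p \Po - 'X) * (q - (q \Po - 'X)).
Proof. by rewrite /qop derivM comp_polyM; ring. Qed.

End Operators.

(** * A nilpotency criterion *)

Section StrictlyTriangular.
Variables (K : fieldType) (N : nat).
Local Notation n := N.+4.

Lemma nilpotent_strict_triangular (P : {linear 'rV[K]_n -> 'rV[K]_n}) :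
  (forall i j, (i <= j < n)%N -> co (P (F1_basis K n j.+1)) i = 0) ->
  exists k, forall x, iter k P x = 0.
Proof.
move=> triP; exists n => x; apply: co_inj => i lt_in; rewrite [RHS]mxE.
suff: forall k j, (j < k)%N -> (j < n)%N -> co (iter k P x) j = 0 by apply.
elim=> [//|k IHk] j le_jk lt_jn.
rewrite iterS [iter k P x]F1_basis_expand linear_sum /= /co summxE big1 // => l _.
rewrite linearZ mxE -coE -[_ 0 (inord j)]/(co _ _).
have [le_jl | lt_lj] := leqP j l; first by rewrite triP ?mulr0 // le_jl ltn_ord.
by rewrite IHk ?mul0r ?ltn_ord //; lia.
Qed.

End StrictlyTriangular.

(** * Necessary conditions on a pre-derivation *)

Section PreDerivation.
Variables (K : numFieldType) (N : nat) (alpha : nat -> K) (theta : K).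
Local Notation n := N.+4.
Local Notation br := (F1_bracket alpha theta).
Local Notation A := (strA N alpha).
Local Notation e := (F1_basis K n).
Local Notation lam := (rmul_pol alpha).

Variable P : {linear 'rV[K]_n -> 'rV[K]_n}.
Hypothesis preP : forall x y z : 'rV[K]_n,
  P (br (br x y) z) =
    br (br (P x) y) z + br (br x (P y)) z + br (br x y) (P z).

Lemma pre_derivation_mvec p y z :
  P (mvec N (p * lam y * lam z)) =
    mvec N (pol (P (mvec N p)) * lam y * lam z
      + p * lam (P y) * lam z + p * lam y * lam (P z)).
Proof.
have pol_p l l' : mvec N (pol (mvec N p) * l * l') = mvec N (p * l * l').
  by apply: mvec_eq; rewrite -!mulrBl !dvdp_mulr // pol_mvec.
by have := preP (mvec N p) y z; rewrite !F1_triple !pol_p -!linearD.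
Qed.

Local Notation a1 := (co (P (e 1)) 0).
Local Notation a2 := (co (P (e 1)) 1).
Local Notation b1 := (co (P (e 2)) 0).
Local Notation b2 := (co (P (e 2)) 1).
Local Notation c1 := (co (P (e 3)) 0).
Local Notation c2 := (co (P (e 3)) 1).
Local Notation C := (a1%:P * 'X + a2%:P * A).

(** The encoding kills e_1 - e_2, hence every triple product starting with it. What remains is
    [pol (P (e 1 - e 2))] times X^2, whose coefficient of X^2 must vanish. *)
Lemma pre_derivation_e12 : a1 + a2 = b1 + b2.
Proof.
have := preP (e 1 - e 2) (e 1) (e 1); rewrite !F1_triple.
have -> : pol (e 1 - e 2) = 0 by rewrite linearB /= !pol_basis // subrr.
rewrite !mul0r !linear0 !addr0 lam_e1 linearB.
move/(congr1 (fun x => co x 3)); rewrite co_mvec // {1}/co mxE -mulrA -expr2 coefMXn /=.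
rewrite subnn linearB coefB !pol_coef0 => /esym/eqP; rewrite mulr1n subr_eq0.
by move/eqP.
Qed.

(** Right multiplication by e_3 is zero, so [[[e_2, e_3], e_1]] leaves only the term with P e_3: X
    (c1 X + c2 A) = 0 mod X^(N+3). *)
Lemma pre_derivation_e3 : c1 = 0 /\ forall k, (k < N.+2)%N -> c2 * A`_k = 0.
Proof.
have := pre_derivation_mvec 1 (e 3) (e 1).
rewrite lam_e3 lam_e1 !(mulr0, mul0r, mul1r) !linear0 addr0 add0r => c0.
have ck k : (k < N.+2)%N -> (lam (P (e 3)))`_k = 0.
  move=> lt_kN; have := congr1 (fun x => co x k.+2) c0.
  by rewrite co_mvec // {1}/co mxE /= coefMX /= mulr1n.
have {}ck k : (k < N.+2)%N -> c1 * (k == 1%N)%:R + c2 * A`_k = 0.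
  by move/ck; rewrite coefD !coefCM coefX.
have c1_0 : c1 = 0 by have := ck 1%N isT; rewrite strA_coef_small // mulr0 addr0 mulr1.
by split=> // k /ck; rewrite c1_0 mul0r add0r.
Qed.

Hypothesis even_part_neq0 : exists k, [&& ~~ odd k, (k <= N)%N & A`_k != 0].

Lemma pre_derivation_c2 : c2 = 0.
Proof.
have [k /and3P[_ le_kN Ak]] := even_part_neq0.
have [_ /(_ k)] := pre_derivation_e3; rewrite ltnS ltnW // => /(_ isT)/eqP.
by rewrite mulf_eq0 (negPf Ak) orbF => /eqP.
Qed.

Local Notation Q p := (pol (P (mvec N p))).

Lemma pre_derivation_pol : exists w,
  [/\ 2 * w * 'X = C + Q 1 * 'X - Q 'X
    & forall p, 'X^(N.+3) %| Q p - qop C (Q 1) w p].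
Proof.
(* Division by X is possible because [Q 'X] has constant coefficient c1 + c2 = 0. Half the quotient
   is the w for which [qop] agrees with Q at X. *)
have [w def_w] : exists w, C + Q 1 * 'X - Q 'X = w * 'X.
  apply/dvdpP; rewrite -['X]expr1; apply/dvdXnP => -[_|//].
  rewrite coefB coefD coefD !coefCM coefX coefMX /= mulr0 strA_coef_small // mulr0.
  rewrite pol_coef0 mvecX pre_derivation_c2.
  by rewrite (proj1 pre_derivation_e3) !addr0 subr0.
exists ((2^-1)%:P * w); split.
  rewrite def_w mulrA; congr (_ * _); rewrite -[2]/(2%:R) -[2%:R]polyC_natr -polyCM.
  by rewrite divff ?polyC1 ?mul1r // pnatr_eq0.
set w' := _ * w.
have w'E : w' + w' = w.
  by rewrite -mulrDl -polyCD -mulr2n -[_ *+ 2]mulr_natr mulVf ?pnatr_eq0 // mul1r.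
(* Agreement at 1 and X propagates in steps of two, since multiplication by X^2 affects both
   operators in the same way. *)
have QXn k : 'X^(N.+3) %| Q 'X^k - qop C (Q 1) w' 'X^k.
  elim/ltn_ind: k => -[|[|k]] IHk.
  - rewrite expr0 /qop -[1]/(1%:P) derivC comp_polyC subrr !mulr0.
    by rewrite add0r subr0 mulr1 subrr dvdp0.
  - rewrite expr1 /qop derivX comp_polyX opprK mulr1 mulrDr -mulrDl w'E -def_w.
    rewrite (_ : _ - _ = 0) ?dvdp0 //; ring.
  have := pre_derivation_mvec 'X^k (e 1) (e 1); rewrite lam_e1 -[lam (P _)]/C => PXk.
  have -> : 'X^(k.+2) = 'X^k * ('X * 'X) :> {poly K} by rewrite mulrA !exprSr.
  rewrite {1}['X^k * ('X * 'X)]mulrA PXk qopM.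
  set t := (X in mvec N X); have tP := pol_mvec N t.
  have := IHk k; rewrite ltnS leqnSn => /(_ isT) kP.
  have -> : pol (mvec N t) - (qop C (Q 1) w' 'X^k * ('X * 'X) + 'X^k * (C * ('X * 'X)^`())
     - w' * ('X^k \Po - 'X) * ('X * 'X - ('X * 'X \Po - 'X))) =
     (pol (mvec N t) - t) + (Q 'X^k - qop C (Q 1) w' 'X^k) * ('X * 'X).
    by rewrite comp_polyM comp_polyX derivM derivX /t; ring.
  by rewrite dvdp_addr ?dvdp_mulr.
move=> p; rewrite -[p]coefK poly_def.
rewrite (linear_sum (qop _ _ _)) (linear_sum (mvec N)) (linear_sum P).
rewrite (linear_sum (@pol K N)).
rewrite -sumrB.
apply: (big_ind (fun q => 'X^(N.+3) %| q)) => [|p1 p2|i _].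
- exact: dvdp0.
- exact: dvdp_add.
by rewrite 4!linearZ /= -scalerBr -mul_polyC dvdp_mull.
Qed.

(** The products [[[p, e_1], e_2]] give p X T = w p(-X) X E mod X^(N+3). Passing from p = 1 to p = X
    flips the relative sign of the two sides, so T and w E vanish separately mod X^(N+1). *)
Lemma pre_derivation_eqs :
  [/\ b1 = 0, b2 = a1 + a2, co (P (e 3)) 2 = a1 + b2
    & 'X^(N.+1) %| C * A^`() - b2%:P * A].
Proof.
have [w [def_w QP]] := pre_derivation_pol.
pose T := C * A^`() - b2%:P * A - b1%:P * 'X.
pose E := A + (A \Po - 'X).
have [k0 /and3P[k0_even le_k0N Ak0]] := even_part_neq0.
have E_k0 : E`_k0 != 0.
  rewrite coefD coef_comp_polyNX -signr_odd (negPf k0_even) mul1r -mulr2n.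
  by rewrite mulrn_eq0.
have key p : 'X^(N.+3) %| p * 'X * T - w * (p \Po - 'X) * ('X * E).
  have := pre_derivation_mvec p (e 1) (e 2); rewrite lam_e1 lam_e2.
  rewrite -[lam (P (e 1))]/C -[lam (P (e 2))]/(b1%:P * 'X + b2%:P * A) => Pp.
  have := QP (p * ('X * A)); rewrite {1}[p * ('X * A)]mulrA Pp qopM.
  set t := (X in mvec N X) => dv1.
  have -> : p * 'X * T - w * (p \Po - 'X) * ('X * E) =
    (pol (mvec N t) - t) - (pol (mvec N t) - (qop C (Q 1) w p * ('X * A)
       + p * (C * ('X * A)^`())
       - w * (p \Po - 'X) * ('X * A - ('X * A \Po - 'X)))) + (Q p - qop C (Q 1) w p) * ('X * A).
    by rewrite comp_polyM comp_polyX derivM derivX /t /T /E; ring.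
  by rewrite dvdp_addr ?dvdp_mulr // dvdp_sub // pol_mvec.
have := key 1; have := key 'X; rewrite comp_polyX -[1]/(1%:P) comp_polyC polyC1.
rewrite mul1r mulr1 => keyX key1.
have n2 : 2 != 0 :> K by rewrite pnatr_eq0.
have half (q : {poly K}) : 'X^(N.+3) %| 2%:P * 'X^2 * q -> 'X^(N.+1) %| q.
  rewrite -mulrA mul_polyC dvdpZr // mulrC -(addn2 N.+1) exprD dvdp_mul2r //.
  by rewrite expf_neq0 // polyX_eq0.
have dvT : 'X^(N.+1) %| T.
  apply: half; have -> : 2%:P * 'X^2 * T =
     'X * ('X * T - w * ('X * E)) + ('X * 'X * T - w * (- 'X) * ('X * E)).
    by rewrite (_ : 2%:P = 2) ?polyC_natr //; ring.
  by rewrite dvdp_addr // dvdp_mull.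
have dvW : 'X^(N.+1) %| w * E.
  apply: half; have -> : 2%:P * 'X^2 * (w * E) =
     ('X * 'X * T - w * (- 'X) * ('X * E)) - 'X * ('X * T - w * ('X * E)).
    by rewrite (_ : 2%:P = 2) ?polyC_natr //; ring.
  by rewrite dvdp_sub // dvdp_mull.
(* Otherwise w is coprime to X and X^(N+1) divides E, against [E_k0]. *)
have w0 : w`_0 = 0.
  apply/eqP; apply: contraNT E_k0 => w0.
  have : 'X^(N.+1) %| E.
    rewrite -(Gauss_dvdpr _ (q := w)) //; apply: coprimep_expl.
    by rewrite coprimep_sym -['X]subr0 -polyC0 coprimep_XsubC rootE horner_coef0.
  by move/dvdXnP => ->.
have [r defA] := strA_XX N alpha.
have k0_ge2 : (2 <= k0)%N by rewrite leqNgt; apply: contra Ak0 => /strA_coef_small ->.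
(* As A is a multiple of X^2, the coefficient of X in T is - b1. *)
have b1_0 : b1 = 0.
  have := dvdXnP _ _ dvT 1%N; rewrite ltnS (leq_trans _ le_k0N) ?(ltnW k0_ge2) //.
  move=> /(_ isT).
  have -> : T =
      (('X * (a1%:P + a2%:P * r * 'X)) * (r^`() * 'X + r * 2) - b2%:P * r * 'X) * 'X - b1%:P * 'X.
    by rewrite /T defA derivM derivXn -mulr_natr; ring.
  rewrite coefB !coefMX /= coefC coefB coefMX coefM big_ord1 coefXM /= mul0r subrr sub0r.
  by move/eqP; rewrite oppr_eq0 => /eqP.
have b2E := pre_derivation_e12; rewrite b1_0 add0r in b2E.
split=> //; last by have := dvT; rewrite /T b1_0 polyC0 mul0r subr0.
have := congr1 (fun q : {poly K} => q`_1) def_w.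
rewrite /= coefMX /= coefB !coefD !coefCM coefX coefMX /=.
rewrite strA_coef_small // mulr0 addr0 mulr1.
rewrite -[2]/(2%:R) -[2%:R]polyC_natr coefCM w0 mulr0 mvec1 pol_coef0 b1_0 add0r.
rewrite pol_coefS // mvecX => /esym/eqP.
by rewrite subr_eq0 => /eqP.
Qed.

(** The assumptions make the images of e_1, e_2 and e_3 strictly triangular. They also make P
    commute with double right multiplication by e_1, which carries this from e_(j+2) to e_(j+4). *)
Lemma pre_derivation_nilpotent : a1 = 0 -> a2 = 0 ->
  exists k, forall x, iter k P x = 0.
Proof.
move=> a1_0 a2_0; have [b1_0 b2_0 c3_0 _] := pre_derivation_eqs.
rewrite a1_0 a2_0 addr0 in b2_0; rewrite b2_0 a1_0 addr0 in c3_0.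
have [c1_0 _] := pre_derivation_e3; have c2_0 := pre_derivation_c2.
apply: nilpotent_strict_triangular => i j; elim/ltn_ind: j i => -[|[|[|j]]] IHj i.
- by case: i.
- by case: i => [|[|]].
- by case: i => [|[|[|]]].
move=> /andP[le_ij lt_jn].
have := pre_derivation_mvec 'X^j (e 1) (e 1).
rewrite lam_e1 /rmul_pol a1_0 a2_0 !mul0r !(mulr0, mul0r, addr0) -!exprSr !mvecXn => ->.
have lt_in : (i < n)%N by apply: leq_ltn_trans lt_jn.
rewrite co_mvec // -mulrA -expr2 coefMXn.
case: ltnP => [_|i_ge]; first by rewrite mul0rn.
case: i le_ij lt_in i_ge => [//|i] le_ij lt_in i_ge /=; rewrite mulr1n.
case: i le_ij lt_in i_ge => [//|[//|i]] le_ij lt_in _; rewrite !subSS subn0.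
have IHj1 k : (k <= j.+1)%N -> co (P (e j.+2)) k = 0.
  by move=> le_kj; apply: IHj => //; rewrite le_kj; lia.
case: i le_ij lt_in => [|i] le_ij lt_in; first by rewrite pol_coef0 !IHj1 ?addr0.
by rewrite pol_coefS; [apply: IHj1; lia | lia].
Qed.

End PreDerivation.

(** * Construction of pre-derivations from [qop] *)

Section QopPreDerivation.
Variables (K : fieldType) (N : nat) (alpha : nat -> K).
Local Notation n := N.+4.
Local Notation A := (strA N alpha).
Local Notation e := (F1_basis K n).
Local Notation lam := (rmul_pol alpha).
Variables (a a' : K) (w : {poly K}).
Local Notation C := (a%:P * 'X + a'%:P * A).
Local Notation Q := (qop C (a + a')%:P w).

(** The kernel of [pol] is spanned by e_1 - e_2, on which the map is multiplication by a. It sends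
    e_1 to a e_1 + a' e_2 and e_2 to (a + a') e_2. *)
Definition qop_map (x : 'rV[K]_n) : 'rV[K]_n :=
  (a * co x 0) *: (e 1 - e 2) + mvec N (Q (pol x)).

Fact qop_map_is_linear : linear qop_map.
Proof.
move=> c x y; rewrite /qop_map co_linear (linearP (@pol K N)) (linearP (qop _ _ _)).
rewrite (linearP (mvec N)) /=.
rewrite [c *: (_ + _)]scalerDr scalerA addrACA.
by rewrite -scalerDl mulrDr mulrCA.
Qed.
HB.instance Definition _ :=
  GRing.isLinear.Build K 'rV[K]_n 'rV[K]_n _ qop_map qop_map_is_linear.

Lemma pol_e1Be2 : pol (e 1 - e 2) = 0.
Proof. by rewrite linearB /= !pol_basis // subrr. Qed.

Lemma qop_map_e1Be2 : qop_map (e 1 - e 2) = a *: (e 1 - e 2).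
Proof.
rewrite /qop_map pol_e1Be2 !linear0 addr0; congr (_ *: _).
by rewrite /co !mxE !inordK //= subr0 mulr1.
Qed.

Lemma subr_comp_polyNX_X (p : {poly K}) : exists q, p - (p \Po - 'X) = q * 'X.
Proof.
apply/dvdpP; rewrite -[X in X %| _]expr1; apply/dvdXnP => -[_|//].
by rewrite coefB coef_comp_polyNX mul1r subrr.
Qed.

Lemma lam_qop_map x :
  lam (qop_map x) = (co x 0)%:P * C + ((a + a') * co x 1)%:P * A.
Proof.
have [r defA] := strA_XX N alpha; have [q defq] := subr_comp_polyNX_X (pol x).
have Q0 : (Q (pol x))`_0 = (a + a') * (co x 0 + co x 1).
  have -> : Q (pol x) = (a + a')%:P * pol x
      + ((a%:P + a'%:P * r * 'X) * (pol x)^`() - w * q) * 'X.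
    by rewrite /qop defq defA; ring.
  by rewrite coefD coefMX /= addr0 coefCM pol_coef0.
have P0 : co (qop_map x) 0 = a * co x 0.
  by rewrite co_linear co_mvec // /co !mxE !inordK //= subr0 mulr1 addr0.
have P1 : co (qop_map x) 1 = a' * co x 0 + (a + a') * co x 1.
  by rewrite co_linear co_mvec //= Q0 /co !mxE !inordK //= sub0r; ring.
by rewrite /rmul_pol P0 P1 !(polyCD, polyCM); ring.
Qed.

(** Thus Q descends to K[X]/X^(N+3): the factor X in C compensates for the derivative. *)
Lemma dvdp_qop p : 'X^(N.+3) %| p -> 'X^(N.+3) %| Q p.
Proof.
case/dvdpP=> q ->; rewrite [q * _]mulrC qopM.
have [r defA] := strA_XX N alpha.
have dvN : 'X^(N.+3) %| (('X^(N.+3) : {poly K}) \Po - 'X).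
  by rewrite rmorphXn /= comp_polyX exprNn dvdp_mull.
apply: dvdp_sub; last by apply/dvdp_mulr/dvdp_mull.
apply: dvdp_add; apply: dvdp_mulr => //.
rewrite /qop derivXn -[N.+3.-1]/(N.+2); apply: dvdp_sub; last by rewrite dvdp_mull ?dvdp_sub.
apply: dvdp_add; last by rewrite dvdp_mull.
rewrite defA -mulr_natl.
have -> : (a%:P * 'X + a'%:P * (r * 'X^2)) * (N.+3%:R * 'X^(N.+2)) =
  ((a%:P + a'%:P * r * 'X) * N.+3%:R) * 'X^(N.+3) by rewrite [in RHS]exprS; ring.
by rewrite dvdp_mull.
Qed.

Local Notation T := (C * A^`() - (a + a')%:P * A).
Local Notation E := (A + (A \Po - 'X)).

(** For y = z = e_1 the identity is automatic. One e_1 and one e_2 leave X times a combination of T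
    - w E and (p - p(-X)) w E, whence the modulus X^(N+2) for T - w E. Two e_2 leave multiples of T
    A and of w E (A - A(-X)), where X^(N+1) suffices because A and A - A(-X) are multiples of
    X^2. *)
Lemma qop_map_pre_derivation (theta : K) (br := F1_bracket alpha theta) :
  'X^(N.+1) %| T -> 'X^(N.+1) %| w * E ->
  'X^(N.+2) %| T - w * E ->
  forall x y z : 'rV[K]_n,
    qop_map (br (br x y) z) =
      br (br (qop_map x) y) z + br (br x (qop_map y)) z
      + br (br x y) (qop_map z).
Proof.
move=> dvT dvW dvTW x y z; rewrite /br !F1_triple !lam_qop_map {1}/qop_map.
rewrite co_mvec // mulr0 scale0r add0r -!linearD /=; apply: mvec_eq.
set p := pol x.
have polQ : 'X^(N.+3) %| pol (qop_map x) - Q p.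
  by rewrite /qop_map linearD linearZ /= pol_e1Be2 scaler0 add0r pol_mvec.
set g := p * lam y * lam z; set h := lam y * lam z.
set y0 := co y 0; set y1 := co y 1; set z0 := co z 0; set z1 := co z 1.
set Y := _ + ((a + a') * y1)%:P * A; set Z := _ + ((a + a') * z1)%:P * A.
have dvQ : 'X^(N.+3) %| Q (pol (mvec N g)) - Q g.
  by rewrite -linearB dvdp_qop // pol_mvec.
have -> : Q (pol (mvec N g))
    - (pol (qop_map x) * lam y * lam z + p * Y * lam z + p * lam y * Z) =
  (Q (pol (mvec N g)) - Q g) - (pol (qop_map x) - Q p) * h
  + (Q (p * h) - (Q p * h + p * Y * lam z + p * lam y * Z)).
  have -> : g = p * h by rewrite mulrA.
  by rewrite /h; ring.
apply: dvdp_add; first by apply: dvdp_sub => //; apply: dvdp_mulr.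
have [r defA] := strA_XX N alpha.
have [q defq] := subr_comp_polyNX_X p.
rewrite qopM.
have -> : Q p * h + p * (C * h^`()) - w * (p \Po - 'X) * (h - (h \Po - 'X))
    - (Q p * h + p * Y * lam z + p * lam y * Z) =
  (y0 * z1 + y1 * z0)%:P * (p * (T - w * E) + (p - (p \Po - 'X)) * (w * E)) * 'X
  + (y1 * z1)%:P * (2 * p * T * A - (p \Po - 'X) * (w * E) * (A - (A \Po - 'X))).
  rewrite /h /Y /Z /rmul_pol -/y0 -/y1 -/z0 -/z1.
  rewrite !(derivM, derivD, derivX, derivC, comp_polyD, comp_polyM, comp_polyX, comp_polyC).
  by rewrite !(polyCD, polyCM); ring.
have XX : 'X^2 %| A - (A \Po - 'X).
  rewrite defA comp_polyM rmorphXn /= comp_polyX sqrrN -mulrBl; exact: dvdp_mull.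
have dvA : 'X^2 %| A by rewrite defA dvdp_mull.
apply: dvdp_add.
  rewrite exprSr; apply: dvdp_mul => //; apply: dvdp_mull; apply: dvdp_add.
    exact: dvdp_mull.
  by rewrite defq -mulrA dvdp_mull // mulrC exprSr dvdp_mul.
apply: dvdp_mull; rewrite -(addn2 N.+1) exprD; apply: dvdp_sub; apply: dvdp_mul => //.
  exact: dvdp_mull.
exact: dvdp_mull.
Qed.

End QopPreDerivation.

(** * Classification *)

Section Classification.
Variables (K : numFieldType) (N : nat) (alpha : nat -> K) (theta : K).
Hypothesis N_even : ~~ odd N.
Local Notation n := N.+4.
Local Notation br := (F1_bracket alpha theta).
Local Notation A := (strA N alpha).
Local Notation e := (F1_basis K n).

Let pre_der (P : {linear 'rV[K]_n -> 'rV[K]_n}) := forall x y z : 'rV[K]_n,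
  P (br (br x y) z) =
    br (br (P x) y) z + br (br x (P y)) z + br (br x y) (P z).

(** With a = a' = 0 and w = -1/2, [qop] is the projection onto odd powers; it fixes X, that is
    e_3. *)
Lemma even_part0_not_nilpotent :
  (forall k, ~~ odd k -> (k <= N)%N -> A`_k = 0) ->
  exists2 P : {linear 'rV[K]_n -> 'rV[K]_n},
    pre_der P & ~ exists k, forall x, iter k P x = 0.
Proof.
move=> A0; exists (qop_map alpha 0 0 (- 2^-1)%:P) => [|[k /(_ (e 3))]].
  have dvE : 'X^(N.+2) %| A + (A \Po - 'X).
    (* As N is even, N + 1 is odd, so E has no term of degree N + 1 whatever the parameters. *)
    apply/dvdXnP => i; rewrite ltnS leq_eqVlt => /predU1P[->|lt_iN].
      by rewrite coefD coef_comp_polyNX -signr_odd /= N_even mulN1r subrr.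
    rewrite coefD coef_comp_polyNX -signr_odd; case: (boolP (odd i)) => [_|i_even].
      by rewrite mulN1r subrr.
    by rewrite A0 // mulr0 addr0.
  have dvN1 : 'X^(N.+1) %| (- 2^-1)%:P * (A + (A \Po - 'X)).
    by rewrite dvdp_mull // (dvdp_trans _ dvE) // dvdp_exp2l.
  apply: qop_map_pre_derivation => //.
    by rewrite !addr0 polyC0 !mul0r addr0 mul0r subrr dvdp0.
  rewrite addr0 polyC0 !mul0r addr0 mul0r subrr sub0r -mulNr; exact: dvdp_mull.
have Pe3 : qop_map alpha 0 0 (- 2^-1)%:P (e 3) = e 3.
  rewrite /qop_map mul0r scale0r add0r pol_basis // /qop !addr0 polyC0 !mul0r addr0.
  rewrite !addr0 !mul0r sub0r /= expr1 comp_polyX opprK -mulNr -polyCN opprK -mvecX.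
  congr mvec; rewrite mulrDr -mulrDl -polyCD -mulr2n -[_ *+ 2]mulr_natr.
  by rewrite mulVf ?mul1r // pnatr_eq0.
have -> : iter k (qop_map alpha 0 0 (- 2^-1)%:P) (e 3) = e 3.
  by elim: k => //= k ->.
move/(congr1 (fun x => co x 2)); rewrite co_basis // /co mxE /= => /eqP.
by rewrite oner_eq0.
Qed.

(** For a = 1 and a' = m - 1, the vector e_1 - e_2 has eigenvalue 1, which excludes nilpotency. *)
Lemma catalan_ode_not_nilpotent m : ~~ odd m -> (2 <= m <= N)%N ->
  'X^m %| A -> A`_m != 0 -> 'X^(N.+1) %| catalan_ode m A ->
  exists2 P : {linear 'rV[K]_n -> 'rV[K]_n},
    pre_der P & ~ exists k, forall x, iter k P x = 0.
Proof.
move=> m_even /andP[m_ge2 le_mN] dvA Am ode.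
pose E := A + (A \Po - 'X).
have E_m : E`_m = A`_m * 2.
  by rewrite coefD coef_comp_polyNX -signr_odd (negPf m_even) mul1r; ring.
have dvE : 'X^m %| E.
  apply/dvdXnP => i lt_im; rewrite coefD coef_comp_polyNX (dvdXnP _ _ dvA) //.
  by rewrite mulr0 addr0.
(* The equation holds only modulo X^(N+1); this monomial gives w E the same coefficient of X^(N+1).
   The division is by 2 A_m, since m is even. *)
pose w := ((catalan_ode m A)`_N.+1 / E`_m)%:P * 'X^(N.+1 - m).
have Em0 : E`_m != 0 by rewrite E_m mulf_neq0 // pnatr_eq0.
have dvW : 'X^(N.+1) %| w * E.
  by rewrite -(subnK (leqW le_mN)) exprD dvdp_mul // dvdp_mull // subnK // leqW.
exists (qop_map alpha 1 m.-1%:R w) => [|[k /(_ (e 1 - e 2))]]; last first.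
  have -> : iter k (qop_map alpha 1 m.-1%:R w) (e 1 - e 2) = e 1 - e 2.
    by elim: k => //= k ->; rewrite qop_map_e1Be2 scale1r.
  move/(congr1 (fun x => co x 0)); rewrite /co !mxE !inordK //= subr0 => /eqP.
  by rewrite oner_eq0.
have defT : (1%:P * 'X + m.-1%:R%:P * A) * A^`() - (1 + m.-1%:R)%:P * A = catalan_ode m A.
  by rewrite /catalan_ode !polyCD !polyC_natr polyC1 mul1r nat1r prednK //; lia.
apply: qop_map_pre_derivation; rewrite ?defT //.
apply/dvdXnP => i; rewrite ltnS leq_eqVlt => /predU1P[->|lt_iN].
  rewrite coefB /w -mulrA coefCM coefXnM ifF; last by lia.
  by rewrite subKn ?divfK ?subrr // leqW.
by rewrite coefB (dvdXnP _ _ ode) // (dvdXnP _ _ dvW) // subrr.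
Qed.

Lemma not_nilpotent_catalan_ode (P : {linear 'rV[K]_n -> 'rV[K]_n}) :
  pre_der P -> ~ (exists k, forall x, iter k P x = 0) ->
  (exists k, [&& ~~ odd k, (k <= N)%N & A`_k != 0]) ->
  exists m, [/\ ~~ odd m, (2 <= m <= N)%N, 'X^m %| A, A`_m != 0
    & 'X^(N.+1) %| catalan_ode m A].
Proof.
move=> preP notnilP hasE.
have [b1_0 b2E _ dvT] := pre_derivation_eqs preP hasE.
set a1 := co (P (e 1)) 0 in b2E dvT; set a2 := co (P (e 1)) 1 in b2E dvT.
have [k0 /and3P[k0_even le_k0N Ak0]] := hasE.
have hasA : exists k, A`_k != 0 by exists k0.
case: (ex_minnP hasA) => m Am min_m.
have le_mk0 := min_m _ Ak0.
have dvA : 'X^m %| A.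
  apply/dvdXnP => i lt_im; apply/eqP; apply: contraTT lt_im => Ai.
  by rewrite -leqNgt min_m.
have m_ge2 : (2 <= m)%N by rewrite leqNgt; apply: contra Am => /strA_coef_small ->.
(* Comparison of the coefficients of X^m in [dvT]. *)
have b2m : co (P (e 2)) 1 = m%:R * a1.
  have [r defA] := dvdpP _ _ dvA.
  have := dvdXnP _ _ dvT m; rewrite ltnS (leq_trans le_mk0) // => /(_ isT).
  have -> : (a1%:P * 'X + a2%:P * A) * A^`() - (co (P (e 2)) 1)%:P * A =
    (((m%:R * a1)%:P - (co (P (e 2)) 1)%:P) * r + (a1%:P * r^`()
      + a2%:P * r * (r^`() * 'X + m%:R * r) * 'X^(m.-2)) * 'X) * 'X^m.
    rewrite defA derivM derivXn -mulr_natl polyCM polyC_natr.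
    have -> : 'X^m = 'X^(m.-2) * 'X * 'X :> {poly K} by rewrite -!exprSr; congr ('X^_); lia.
    have -> : 'X^(m.-1) = 'X^(m.-2) * 'X :> {poly K} by rewrite -!exprSr; congr ('X^_); lia.
    by ring.
  rewrite coefMXn ltnn subnn coefD coefMX /= addr0 -polyCB coefCM => /eqP.
  have r0 : r`_0 != 0 by move: Am; rewrite defA coefMXn ltnn subnn.
  by rewrite mulf_eq0 (negPf r0) orbF subr_eq0 => /eqP.
have a1_neq0 : a1 != 0.
  apply/eqP => a1_0; apply: notnilP; apply: (pre_derivation_nilpotent preP hasE) => //.
  by rewrite -[LHS]add0r -a1_0 -/a2 -b2E b2m a1_0 mulr0.
have a2E : a2 = m.-1%:R * a1.
  apply: (addrI a1); rewrite -b2E b2m -{2}[a1]mul1r -mulrDl nat1r prednK //; lia.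
have ode : 'X^(N.+1) %| catalan_ode m A.
  move: dvT; rewrite b2m a2E.
  have -> : (a1%:P * 'X + (m.-1%:R * a1)%:P * A) * A^`() - (m%:R * a1)%:P * A =
      a1 *: catalan_ode m A.
    by rewrite -mul_polyC /catalan_ode !polyCM !polyC_natr; ring.
  by rewrite dvdpZr.
exists m; split => //; last by rewrite m_ge2 (leq_trans le_mk0).
(* For odd m a Catalan polynomial has only odd powers, against the nonzero coefficient at the even
   degree k0. *)
have := dvdXnP _ _ (catalan_ode_sol m_ge2 dvA ode) k0.
rewrite ltnS le_k0N coefB => /(_ isT)/eqP; rewrite subr_eq0 => /eqP Ak0E.
apply/negP => m_odd; move: Ak0.
rewrite Ak0E catalan_poly_coef0 ?eqxx // => -[t [t_gt0 def_k0]].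
move: k0_even m_odd; rewrite def_k0 -[in odd m](prednK (ltnW m_ge2)) /= oddM negbK.
by case/andP=> ->.
Qed.

(** * Translation into conditions on the parameters *)

Lemma alpha_strA k : (4 <= k <= n - 2)%N -> alpha k = A`_(k - 2).
Proof. by move=> k_bound; rewrite strA_coef; [congr alpha|]; lia. Qed.

Lemma strA_alpha k : (2 <= k <= N)%N -> A`_k = alpha k.+2.
Proof. by move=> k_bound; rewrite strA_coef //; lia. Qed.

Lemma catalan_ode_of_coefs m : (2 <= m <= N)%N ->
  (forall t, (0 < t)%N -> ((m.-1 * t).+1 <= N)%N ->
     A`_(m.-1 * t).+1 = (-1) ^+ t.+1 * pCatalan K m t * A`_m ^+ t) ->
  (forall k, (2 <= k <= N)%N ->
     ~ (exists t, (0 < t)%N /\ k = (m.-1 * t).+1) -> A`_k = 0) ->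
  'X^m %| A /\ 'X^(N.+1) %| catalan_ode m A.
Proof.
move=> /andP[m_ge2 le_mN] At A0.
have eqA : 'X^(N.+1) %| A - catalan_poly m N.+2 A`_m.
  apply/dvdXnP => k; rewrite ltnS coefB => le_kN; apply/eqP; rewrite subr_eq0; apply/eqP.
  (* Both k = 0 and k = 1 have [k.-1] equal to 0, so quotient zero means k < 2. *)
  have [/dvdnP[[|t] def_k] | k_out] := boolP (m.-1 %| k.-1)%N.
  - have k_small : (k < 2)%N by lia.
    have -> : A`_k = 0 by exact: strA_coef_small.
    apply/esym/catalan_poly_coef0 => // -[t [t_gt0 def_k']].
    by move: k_small; rewrite def_k'; nia.
  - have -> : k = (m.-1 * t.+1).+1 by nia.
    by rewrite catalan_poly_coef ?At //; nia.
  have no_t : ~ exists t, (0 < t)%N /\ k = (m.-1 * t).+1.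
    by case=> t [_ def_k]; move: k_out; rewrite def_k dvdn_mulr.
  rewrite catalan_poly_coef0 //; have [k_lt2|k_ge2] := ltnP k 2.
    exact: strA_coef_small.
  by apply: A0; rewrite ?k_ge2.
have dvA : 'X^m %| A.
  apply/dvdXnP => i lt_im; have := dvdXnP _ _ eqA i.
  rewrite coefB (dvdXnP _ _ (dvdXn_catalan_poly _ m_ge2 _)) // subr0; apply; lia.
by split=> //; apply: (catalan_poly_dvd_ode _ _ _ dvA eqA).
Qed.

Lemma coefs_of_catalan_ode m : (2 <= m <= N)%N -> 'X^m %| A ->
  'X^(N.+1) %| catalan_ode m A ->
  (forall t, (0 < t)%N -> ((m.-1 * t).+1 <= N)%N ->
     A`_(m.-1 * t).+1 = (-1) ^+ t.+1 * pCatalan K m t * A`_m ^+ t) /\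
  (forall k, (2 <= k <= N)%N ->
     ~ (exists t, (0 < t)%N /\ k = (m.-1 * t).+1) -> A`_k = 0).
Proof.
move=> /andP[m_ge2 le_mN] dvA ode.
have eqA k : (k <= N)%N -> A`_k = (catalan_poly m N.+3 A`_m)`_k.
  move=> le_kN; have := dvdXnP _ _ (catalan_ode_sol m_ge2 dvA ode) k.
  by rewrite ltnS coefB => /(_ le_kN)/eqP; rewrite subr_eq0 => /eqP.
split=> [t t_gt0 le_tN | k /andP[_ le_kN] k_out]; rewrite eqA //.
  by apply: catalan_poly_coef => //; nia.
exact: catalan_poly_coef0.
Qed.

Let cond1 := alpha 4%N != 0 /\ (forall k : nat, (5 <= k <= n - 2)%N ->
  alpha k = (-1) ^+ k * pCatalan K 2 (k - 3) * alpha 4%N ^+ (k - 3)).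
Let cond2 := exists s : nat,
  [/\ (3 <= s <= (n - 2) %/ 2)%N,
      forall t : nat, (1 <= t <= (n - 5) %/ (2 * s - 3))%N ->
        alpha ((2 * s - 3) * t + 3)%N =
          (-1) ^+ t.+1 * pCatalan K (2 * s - 2) t * alpha (2 * s)%N ^+ t
    & forall j : nat, (4 <= j <= n - 2)%N ->
        ~ (exists t : nat, (0 < t)%N /\ j = ((2 * s - 3) * t + 3)%N) ->
        alpha j = 0].
Let cond3 := forall i : nat, (2 <= i <= (n - 2) %/ 2)%N -> alpha (2 * i)%N = 0.

Lemma cond3P : cond3 <-> (forall k, ~~ odd k -> (k <= N)%N -> A`_k = 0).
Proof.
split=> [c3 k k_even le_kN | A0 i i_bound]; last first.
  by rewrite alpha_strA; [apply: A0|]; lia.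
have [k_lt2|k_ge2] := ltnP k 2; first exact: strA_coef_small.
rewrite strA_alpha ?k_ge2 // (_ : k.+2 = (2 * (k./2).+1)%N); last by lia.
by apply: c3; lia.
Qed.

(** The order m = 2 gives case i), and an even m >= 4 gives case ii) with m = 2s - 2. The exponent
    (m-1) t + 1 becomes the index (2s-3) t + 3 because A has alpha_(k+2) at X^k. *)
Lemma catalan_ode_cond m : ~~ odd m -> (2 <= m <= N)%N -> 'X^m %| A ->
  A`_m != 0 -> 'X^(N.+1) %| catalan_ode m A -> cond1 \/ cond2.
Proof.
move=> m_even m_bound dvA Am ode.
have [At A0] := coefs_of_catalan_ode m_bound dvA ode.
have [m2 | m_neq2] := eqVneq m 2.
  left; rewrite {}m2 in m_even m_bound dvA Am ode At A0.
  have a4 : alpha 4 = A`_2 by rewrite strA_alpha.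
  split=> [|k k_bound]; first by rewrite a4.
  have := At (k - 3)%N; rewrite /= mul1n => /(_ _ _) Ak.
  rewrite a4 alpha_strA; last by lia.
  rewrite (_ : k - 2 = (k - 3).+1)%N ?Ak; try by lia.
  (* The exponents k and (k - 3) + 1 of the sign have the same parity. *)
  congr (_ * _ * _); rewrite -[LHS]signr_odd -[RHS]signr_odd.
  by congr (_ ^+ nat_of_bool _); lia.
right; exists (m./2.+1).
have -> : (2 * m./2.+1 - 3 = m.-1)%N by lia.
have -> : (2 * m./2.+1 - 2 = m)%N by lia.
have -> : (2 * m./2.+1 = m.+2)%N by lia.
split=> [|t /andP[t_gt0 le_t]|j j_bound j_out]; first by lia.
  have le_tN : ((m.-1 * t).+1 <= N)%N.
    by move: le_t; rewrite leq_divRL; [lia | lia].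
  by rewrite -strA_alpha // -At // addn3 strA_alpha //; nia.
rewrite alpha_strA // A0 //; first by lia.
by case=> t [t_gt0 def_j]; apply: j_out; exists t; split=> //; lia.
Qed.

(** Case iii) absorbs the degenerate situations: for n = 4 it is vacuous, and in case ii) with
    alpha_(2s) = 0 all constrained parameters vanish. *)
Lemma cond_catalan_ode : cond1 \/ cond2 -> cond3 \/
  exists m, [/\ ~~ odd m, (2 <= m <= N)%N, 'X^m %| A, A`_m != 0
    & 'X^(N.+1) %| catalan_ode m A].
Proof.
case=> [[a4 ak] | [s [s_bound at_ a0]]].
  have [N_lt2 | N_ge2] := ltnP N 2; first by left=> i; lia.
  have a4E : alpha 4 = A`_2 by rewrite strA_alpha.
  right; exists 2; have [//|||dvA ode] := @catalan_ode_of_coefs 2; last first.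
  - by rewrite -a4E.
  - move=> k k_bound []; exists k.-1; rewrite mul1n; split; lia.
  - move=> t t_gt0; rewrite /= mul1n => le_tN.
    (* Case i) starts at k = 5, that is t = 2; for t = 1 the formula is the tautology alpha_4 =
       alpha_4. *)
    have [->|t_neq1] := eqVneq t 1%N.
      by rewrite /pCatalan bin1 expr2 mulrNN divff ?pnatr_eq0 // !mul1r expr1.
    rewrite strA_alpha; last by lia.
    rewrite ak; last by lia.
    rewrite -a4E (_ : t.+3 - 3 = t)%N; last by lia.
    by rewrite [(-1) ^+ t.+3]exprS exprS mulrA mulrNN !mul1r.
have [a2s0 | a2s] := eqVneq (alpha (2 * s)%N) 0.
  left=> i i_bound; have [/dvdnP[t def_i] | i_out] := boolP (2 * s - 3 %| 2 * i - 3)%N.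
    have -> : (2 * i = (2 * s - 3) * t + 3)%N by lia.
    have t_gt0 : (0 < t)%N by case: t def_i => //; lia.
    rewrite at_ ?t_gt0 ?leq_divRL; [| lia | lia].
    by rewrite a2s0 expr0n (gtn_eqF t_gt0) mulr0.
  apply: a0; first by lia.
  by case=> t [_ def_i]; move: i_out; rewrite def_i addnK dvdn_mulr.
have a2sE : alpha (2 * s)%N = A`_(2 * s - 2) by rewrite alpha_strA //; lia.
have m_bound : (2 <= 2 * s - 2 <= N)%N by lia.
have defm1 : ((2 * s - 2).-1 = 2 * s - 3)%N by lia.
right; exists (2 * s - 2)%N; have [||dvA ode] := catalan_ode_of_coefs m_bound.
- rewrite defm1 => t t_gt0 le_tN; rewrite -a2sE -at_ ?t_gt0 ?leq_divRL; try by lia.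
  by rewrite strA_alpha; [congr alpha; lia | nia].
- rewrite defm1 => k k_bound k_out; rewrite strA_alpha //; apply: a0; first by lia.
  by case=> t [t_gt0 def_k]; apply: k_out; exists t; split=> //; lia.
split=> //; first by lia.
by rewrite -a2sE.
Qed.

Lemma F1_not_strongly_nilpotent :
  ~ (forall P : {linear 'rV[K]_n -> 'rV[K]_n}, pre_der P ->
       exists k, forall x, iter k P x = 0) <-> [\/ cond1, cond2 | cond3].
Proof.
split=> [notnil | cond].
  (* Classical logic extracts a non-nilpotent pre-derivation P from the negated universal
     statement. *)
  apply: NNPP => no_cond; apply: notnil => P preP; apply: NNPP => notnilP.
  have [/existsP[k /and3P[]] | noE] := boolP
    [exists k : 'I_N.+1, [&& ~~ odd k, (k <= N)%N & A`_k != 0]].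
    move=> k_even le_kN Ak; apply: no_cond.
    have [|m [m_even m_bound dvA Am ode]] := not_nilpotent_catalan_ode preP notnilP.
      by exists k; rewrite k_even le_kN.
    have [c|c] := catalan_ode_cond m_even m_bound dvA Am ode.
      by constructor 1.
    by constructor 2.
  apply: no_cond; constructor 3; apply/cond3P => k k_even le_kN.
  move: noE; rewrite negb_exists => /forallP/(_ (Ordinal (le_kN : k < N.+1)%N)) /=.
  by rewrite k_even le_kN /= negbK => /eqP.
have [P preP notnilP] : exists2 P : {linear 'rV[K]_n -> 'rV[K]_n},
    pre_der P & ~ exists k, forall x, iter k P x = 0.
  have [c3 | [m [m_even m_bound dvA Am ode]]] : cond3 \/
      exists m, [/\ ~~ odd m, (2 <= m <= N)%N, 'X^m %| A, A`_m != 0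
        & 'X^(N.+1) %| catalan_ode m A].
  - case: cond => c; last by left.
      by apply: cond_catalan_ode; left.
    by apply: cond_catalan_ode; right.
  - by apply: even_part0_not_nilpotent; apply/cond3P.
  - exact: catalan_ode_not_nilpotent m_even m_bound dvA Am ode.
by move/(_ P preP).
Qed.

End Classification.

Theorem theorem4p2 (R : realType) (n : nat) (hn : (4 <= n)%N)
    (n_even : ~~ odd n) (alpha : nat -> R[i]) (theta : R[i]) :
  non_strongly_nilpotent (F1 hn alpha theta) <->
  [\/ (* i) *)
      alpha 4%N != 0 /\
      (forall k : nat, (5 <= k <= n - 2)%N ->
         alpha k =
           (-1) ^+ k * pCatalan R[i] 2 (k - 3) * alpha 4%N ^+ (k - 3)),
      (* ii) *)
      exists s : nat,
        [/\ (3 <= s <= (n - 2) %/ 2)%N,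
            forall t : nat, (1 <= t <= (n - 5) %/ (2 * s - 3))%N ->
              alpha ((2 * s - 3) * t + 3)%N =
                (-1) ^+ t.+1 * pCatalan R[i] (2 * s - 2) t
                  * alpha (2 * s)%N ^+ t
          & forall j : nat, (4 <= j <= n - 2)%N ->
              ~ (exists t : nat, (0 < t)%N /\ j = ((2 * s - 3) * t + 3)%N) ->
              alpha j = 0]
    | (* iii) *)
      forall i : nat, (2 <= i <= (n - 2) %/ 2)%N -> alpha (2 * i)%N = 0].
Proof.
case: n hn n_even => [|[|[|[|N]]]] // hn; rewrite /= !negbK => N_even.
exact: F1_not_strongly_nilpotent.
Qed.
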